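(* Let $(L|K,\nu)$ be an extension of valued fields, and $l_1,\dots,l_n$ nonzero elements of $L$. The family $(l_1,\dots,l_n)$ is separated over $(K,\nu)$ if, and only if, $in_\nu(l_1),\dots,in_\nu(l_n)$ are linearly independent over $G_\nu(K)$. If $(l_1,\dots,l_n)$ is a maximal separated family, then $(in_\nu(l_1),\dots,in_\nu(l_n))$ is a basis of the $G_\nu(K)$-module $G_\nu(L)$. Assume that $L|K$ is finite. Then $(L|K,\nu)$ is vs defectless if, and only if, $G_\nu(L)$ is a $G_\nu(K)$-module of dimension $[L:K]$.
   Context: Here $\nu$ is a field valuation on $L$ (values in a linearly ordered abelian group together with $\infty$). It is assumed that $\nu K$ has finite rank (finitely many convex subgroups). For $\gamma\in\nu L$ and a subfield (or $K$-submodule) $M$ of $L$, $M_{\gamma,\nu}:=\{x\in M:\nu(x)\ge\gamma\}/\{x\in M:\nu(x)>\gamma\}$, and $G_\nu(M):=\bigoplus_{\gamma\in\nu M}M_{\gamma,\nu}$, where $\nu M=\{\nu(x):x\in M\}\setminus\{\infty\}$. For $x\ne0$, $in_\nu(x)$ is the class of $x$ in $M_{\nu(x),\nu}\subseteq G_\nu(M)$. $G_\nu(K)$ and $G_\nu(L)$ are graded algebras with multiplication determined by $in_\nu(x)in_\nu(y)=in_\nu(xy)$, and $G_\nu(L)$ is a $G_\nu(K)$-module. The dimension of the module is the cardinality of a basis. A family $(l_1,\dots,l_n)$ is separated over $(K,\nu)$ if $\nu(x_1l_1+\cdots+x_nl_n)=\min_{1\le i\le n}\nu(x_il_i)$ for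 all $x_1,\dots,x_n\in K$. $(L|K,\nu)$ is vs defectless if every finitely generated $K$-submodule of $L$ admits a basis which is separated over $K$. *)

(* Defs.v *)
From HB Require Import structures.
From mathcomp Require Import all_boot all_order all_algebra.
From mathcomp Require Import ring_quotient finmap.
From mathcomp Require Import boolp classical_sets cardinality.

Set Implicit Arguments.
Unset Strict Implicit.
Unset Printing Implicit Defensive.

Import Order.TTheory GRing.Theory Num.Theory.
Local Open Scope quotient_scope.
Local Open Scope classical_set_scope.
Local Open Scope ring_scope.

(* Built on [porderZmodType]: MathComp has no join of [orderType] and
   [zmodType] below [realDomainType], and Hierarchy Builder rejects one that is
   declared afterwards. *)
HB.mixin Record isOrderedAbelianGroup G of Num.POrderedZmodule G := {
  oag_le_total : total (<=%R : rel G);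
  oag_leD2_subproof : forall x y z : G, x <= y -> x + z <= y + z
}.

#[short(type="oagType")]
HB.structure Definition OrderedAbelianGroup :=
  { G of isOrderedAbelianGroup G & Num.POrderedZmodule G }.

HB.instance Definition _ (G : oagType) :=
  Order.POrder_isTotal.Build ring_display G oag_le_total.

(* A field L containing the field K (through k |-> k%:A), of arbitrary degree;
   [fieldExtType] only covers finite extensions. *)
#[short(type="extFieldType")]
HB.structure Definition ExtField (K : fieldType) :=
  { L of GRing.Field L & GRing.Algebra K L }.

Section OrderedAbelianGroupTheory.
Variable G : oagType.
Implicit Types x y z t : G.

Lemma oag_leD2r z x y : (x + z <= y + z) = (x <= y).
Proof.
apply/idP/idP; last exact: oag_leD2_subproof.
by move=> /(oag_leD2_subproof _ _ (- z)); rewrite !addrK.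
Qed.

Lemma oag_leD2l z x y : (z + x <= z + y) = (x <= y).
Proof. by rewrite ![z + _]addrC oag_leD2r. Qed.

Lemma oag_leD x y z t : x <= y -> z <= t -> x + z <= y + t.
Proof.
by move=> xy zt; apply: (@le_trans _ _ (y + z)); rewrite ?oag_leD2r ?oag_leD2l.
Qed.

Lemma oag_ltD2r z x y : (x + z < y + z) = (x < y).
Proof. by rewrite !lt_neqAle oag_leD2r (inj_eq (addIr z)). Qed.

Lemma oag_ltD x y z t : x < y -> z <= t -> x + z < y + t.
Proof.
move=> xy zt; apply: (@lt_le_trans _ _ (y + z)); first by rewrite oag_ltD2r.
by rewrite oag_leD2l.
Qed.
End OrderedAbelianGroupTheory.

Inductive withtop (G : Type) := Fin of G | Infty.
Arguments Infty {G}.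

Section WithTop.
Variable G : oagType.
Implicit Types a b c : withtop G.

Definition option_of_withtop a := if a is Fin g then Some g else None.
Definition withtop_of_option (o : option G) :=
  if o is Some g then Fin g else Infty.
Lemma option_of_withtopK : cancel option_of_withtop withtop_of_option.
Proof. by case. Qed.

HB.instance Definition _ :=
  Choice.copy (withtop G) (can_type option_of_withtopK).

Definition wle a b :=
  match a, b with
  | _, Infty => true
  | Infty, Fin _ => false
  | Fin g, Fin h => g <= h
  end.

Lemma wle_refl : reflexive wle. Proof. by case=> //= g. Qed.
Lemma wle_anti : antisymmetric wle.
Proof. by move=> [g|] [h|] //= /le_anti ->. Qed.
Lemma wle_trans : transitive wle.
Proof. by move=> [g|] [h|] [k|] //=; apply: le_trans. Qed.
Lemma wle_total : total wle.
Proof. by move=> [g|] [h|] //=; apply: le_total. Qed.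

HB.instance Definition _ := Order.Le_isPOrder.Build ring_display (withtop G)
  wle_refl wle_anti wle_trans.
HB.instance Definition _ :=
  Order.POrder_isTotal.Build ring_display (withtop G) wle_total.

Lemma wlex1 a : a <= Infty. Proof. by case: a. Qed.
HB.instance Definition _ := Order.hasTop.Build ring_display (withtop G) wlex1.

Definition wadd a b :=
  match a, b with Fin g, Fin h => Fin (g + h) | _, _ => Infty end.
Lemma waddA : associative wadd.
Proof. by move=> [g|] [h|] [k|] //=; rewrite addrA. Qed.
Lemma waddC : commutative wadd.
Proof. by move=> [g|] [h|] //=; rewrite addrC. Qed.
Lemma wadd0 : left_id (Fin 0) wadd.
Proof. by move=> [g|] //=; rewrite add0r. Qed.
HB.instance Definition _ := GRing.isNmodule.Build (withtop G) waddA waddC wadd0.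

Lemma wleE (g h : G) : (Fin g <= Fin h) = (g <= h). Proof. by []. Qed.
Lemma wltE (g h : G) : (Fin g < Fin h) = (g < h).
Proof. by rewrite !lt_neqAle wleE. Qed.
Lemma wlt_infty (g : G) : Fin g < Infty.
Proof. by rewrite lt_neqAle. Qed.
End WithTop.

(* The value group is the set of finite values; it need not be all of G. *)
Record valuation (F : fieldType) (G : oagType) := Valuation {
  val_fun :> F -> withtop G;
  val_eq_infty : forall x, (val_fun x == Infty) = (x == 0);
  val_mul : forall x y, val_fun (x * y) = val_fun x + val_fun y;
  val_add : forall x y,
    Order.min (val_fun x) (val_fun y) <= val_fun (x + y)
}.

Section ValuationTheory.
Variables (F : fieldType) (G : oagType) (v : valuation F G).

Lemma val0 : v 0 = Infty. Proof. by apply/eqP; rewrite val_eq_infty. Qed.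

Lemma val_finite x : x != 0 -> exists g, v x = Fin g.
Proof. by rewrite -(val_eq_infty v); case: (v x) => // g _; exists g. Qed.

Lemma val1 : v 1 = Fin 0.
Proof.
have [g vg] := val_finite (oner_neq0 F).
have := val_mul v 1 1; rewrite mulr1 vg => -[/(congr1 (fun t => t - g))].
by rewrite addrK subrr => <-.
Qed.

Lemma valN1 : v (-1) = Fin 0.
Proof.
have n1 : -1 != 0 :> F by rewrite oppr_eq0 oner_neq0.
have [g vg] := val_finite n1.
have := val_mul v (-1) (-1); rewrite mulrNN mulr1 vg val1 => -[/esym gg0].
congr Fin; apply: le_anti; apply/andP; split; rewrite leNgt; apply/negP => h.
- by have := oag_ltD h (ltW h); rewrite addr0 gg0 ltxx.
- by have := oag_ltD h (ltW h); rewrite addr0 gg0 ltxx.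
Qed.

Lemma valN x : v (- x) = v x.
Proof. by rewrite -mulN1r val_mul valN1 add0r. Qed.

Definition value_group : set G := [set g | exists x, v x = Fin g].
End ValuationTheory.

Section Restriction.
Variables (K : fieldType) (L : extFieldType K) (G : oagType).
Variable v : valuation L G.

Lemma val_res_eq_infty (k : K) : (v k%:A == Infty) = (k == 0).
Proof. by rewrite val_eq_infty scaler_eq0 oner_eq0 orbF. Qed.
Lemma val_res_mul (k k' : K) : v (k * k')%:A = v k%:A + v k'%:A.
Proof. by rewrite -val_mul mulr_algl scalerA. Qed.
Lemma val_res_add (k k' : K) :
  Order.min (v k%:A) (v k'%:A) <= v (k + k')%:A.
Proof. by rewrite scalerDl val_add. Qed.

Definition val_res : valuation K G :=
  @Valuation K G (fun k => v k%:A) val_res_eq_infty val_res_mul val_res_add.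
End Restriction.
Arguments val_res K {L G} v.

Section Rank.
Variables (G : oagType) (A : set G).

Definition convex_subgroup (H : set G) :=
  [/\ H `<=` A, H 0, (forall x y, H x -> H y -> H (x - y)) &
      forall x y, A x -> H y -> 0 <= x <= y -> H x].

Definition finite_rank := finite_set [set H | convex_subgroup H].
End Rank.

(* External direct sum of a family of abelian groups over an arbitrary index
   type. *)
Section DirectSum.
Variables (I : choiceType) (A : I -> zmodType).

Record dsum := DSum {
  dsum_fun :> forall i, A i;
  dsum_finite : finite_set [set i | dsum_fun i != 0]
}.

Lemma dsumP (f g : dsum) : (forall i, f i = g i) -> f = g.
Proof.
case: f g => [f ff] [g gf] /= fg.
have E : f = g by apply: functional_extensionality_dep.
by subst g; congr DSum; apply: Prop_irrelevance.
Qed.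

HB.instance Definition _ := gen_eqMixin dsum.
HB.instance Definition _ := gen_choiceMixin dsum.

Lemma dsum0_finite : finite_set [set i | (0 : A i) != 0].
Proof.
by rewrite [X in finite_set X](_ : _ = set0)//; apply/seteqP; split=> i //=;
  rewrite eqxx.
Qed.
Definition dsum0 : dsum := DSum dsum0_finite.

Lemma dsumN_finite (f : dsum) : finite_set [set i | - f i != 0].
Proof.
by apply: sub_finite_set (dsum_finite f) => i /=; rewrite oppr_eq0.
Qed.
Definition dsumN f : dsum := DSum (dsumN_finite f).

Lemma dsumD_finite (f g : dsum) : finite_set [set i | f i + g i != 0].
Proof.
have fin : finite_set ([set i | f i != 0] `|` [set i | g i != 0]).
  by rewrite finite_setU; split; apply: dsum_finite.
apply: sub_finite_set fin => i /= fg.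
have [f0|] := eqVneq (f i) 0; last by left.
by right; move: fg; rewrite f0 add0r.
Qed.
Definition dsumD f g : dsum := DSum (dsumD_finite f g).

Lemma dsumDA : associative dsumD.
Proof. by move=> f g h; apply: dsumP => i /=; rewrite addrA. Qed.
Lemma dsumDC : commutative dsumD.
Proof. by move=> f g; apply: dsumP => i /=; rewrite addrC. Qed.
Lemma dsum0D : left_id dsum0 dsumD.
Proof. by move=> f; apply: dsumP => i /=; rewrite add0r. Qed.
Lemma dsumND : left_inverse dsum0 dsumN dsumD.
Proof. by move=> f; apply: dsumP => i /=; rewrite addNr. Qed.

HB.instance Definition _ :=
  GRing.isZmodule.Build dsum dsumDA dsumDC dsum0D dsumND.

Implicit Types (f : dsum) (i j : I).

Lemma dsum0E i : (0 : dsum) i = 0. Proof. by []. Qed.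
Lemma dsumDE (f g : dsum) i : (f + g) i = f i + g i. Proof. by []. Qed.
Lemma dsum_sumE (J : Type) (s : seq J) (f : J -> dsum) i :
  (\sum_(j <- s) f j) i = \sum_(j <- s) f j i.
Proof.
by elim: s => [|j s IH]; rewrite ?big_nil// !big_cons dsumDE IH.
Qed.

Definition dsingle_fun i (a : A i) j : A j :=
  if i =P j is ReflectT e then ecast k (A k) e a else 0.

Lemma dsingle_finite i (a : A i) : finite_set [set j | dsingle_fun a j != 0].
Proof.
apply: sub_finite_set (finite_set1 i) => j /=; rewrite /dsingle_fun.
by case: eqP => [e _|_]; [rewrite e | rewrite eqxx].
Qed.
Definition dsingle i (a : A i) : dsum := DSum (dsingle_finite a).

Lemma dsingle_eq i (a : A i) : dsingle a i = a.
Proof.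
rewrite /= /dsingle_fun; case: eqP => // e.
by rewrite (Prop_irrelevance e erefl).
Qed.

Lemma dsingle_neq i (a : A i) j : i != j -> dsingle a j = 0.
Proof. by rewrite /= /dsingle_fun; case: eqP. Qed.

Lemma dsingle_add i (a b : A i) : dsingle (a + b) = dsingle a + dsingle b.
Proof.
apply: dsumP => j; rewrite dsumDE; have [<-|ij] := eqVneq i j.
  by rewrite !dsingle_eq.
by rewrite !dsingle_neq// addr0.
Qed.

Lemma dsingle0 i : dsingle (0 : A i) = 0.
Proof.
apply: dsumP => j; have [<-|ij] := eqVneq i j; first by rewrite dsingle_eq.
by rewrite dsingle_neq.
Qed.

Definition dsupp (f : dsum) : {fset I} := fset_set [set i | f i != 0].

Lemma dsuppP f i : reflect (f i <> 0) (i \in dsupp f).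
Proof.
rewrite in_fset_set; last exact: dsum_finite.
by apply: (iffP idP) => [|/eqP h]; rewrite inE // => /eqP.
Qed.

Section Lift.
Variables (B : zmodType) (phi : forall i, A i -> B).

(* The homomorphism out of the direct sum extending the phi i. *)
Definition dlift (f : dsum) : B := \sum_(i <- dsupp f) phi (f i).

Hypothesis phiD : forall i, {morph @phi i : a b / a + b}.

Lemma dlift_phi0 i : phi (0 : A i) = 0.
Proof. by apply: (addIr (phi (0 : A i))); rewrite -phiD !add0r. Qed.

Lemma dlift_widen f (s : {fset I}) :
  (dsupp f `<=` s)%fset -> dlift f = \sum_(i <- s) phi (f i).
Proof.
move=> fs; apply: big_fset_incl => // i _ ni.
have [->|/eqP/dsuppP] := eqVneq (f i) 0; first exact: dlift_phi0.
by rewrite (negPf ni).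
Qed.

Lemma dliftD : {morph dlift : f g / f + g}.
Proof.
move=> f g; set s := (dsupp f `|` dsupp g `|` dsupp (f + g)%R)%fset.
have sf : (dsupp f `<=` s)%fset by rewrite /s -fsetUA fsubsetUl.
have sg : (dsupp g `<=` s)%fset by rewrite /s fsetUAC fsubsetUr.
have sfg : (dsupp (f + g)%R `<=` s)%fset by rewrite /s fsubsetUr.
rewrite (dlift_widen sf) (dlift_widen sg) (dlift_widen sfg) -big_split /=.
by apply: eq_bigr => i _; rewrite phiD.
Qed.

Lemma dlift_single i (a : A i) : dlift (dsingle a) = phi a.
Proof.
rewrite (@dlift_widen _ [fset i]%fset) ?big_seq_fset1 ?dsingle_eq//.
apply/fsubsetP => j /dsuppP; rewrite inE.
by have [//|ij] := eqVneq j i; rewrite dsingle_neq// eq_sym.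
Qed.
End Lift.

Lemma dsum_decomp f : f = \sum_(i <- dsupp f) dsingle (f i).
Proof.
apply: dsumP => j; rewrite dsum_sumE.
have [jf|jf] := boolP (j \in dsupp f).
  rewrite (big_fsetD1 j)//= [X in _ + X]big1_fset ?addr0.
    by rewrite -[RHS]/(dsingle (f j) j) dsingle_eq.
  move=> i; rewrite !inE => /andP[ij _] _; exact: dsingle_neq.
have -> : f j = 0 by have [//|/eqP/dsuppP] := eqVneq (f j) 0; rewrite (negPf jf).
rewrite big1_fset// => i fi _; apply: dsingle_neq.
by apply: contraNneq jf => <-.
Qed.

Lemma dsum_ind (P : dsum -> Prop) :
  P 0 -> (forall f g, P f -> P g -> P (f + g)) ->
  (forall i (a : A i), P (dsingle a)) -> forall f, P f.
Proof.
by move=> P0 PD P1 f; rewrite [f]dsum_decomp; apply: (big_ind P) => // i _.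
Qed.

End DirectSum.

Section GradedRing.
Variables (F : fieldType) (G : oagType) (v : valuation F G).
Implicit Types (g h : G) (x y : F).

Definition val_ge g : {pred F} := [pred x | Fin g <= v x].

Lemma val_ge_zmod_closed g : zmod_closed (val_ge g).
Proof.
split=> [|x y]; rewrite !inE ?val0 ?wlex1// => gx gy.
apply: le_trans (val_add v x (- y)).
by rewrite le_min gx valN gy.
Qed.
HB.instance Definition _ g :=
  GRing.isZmodClosed.Build F (val_ge g) (val_ge_zmod_closed g).

Record filtered g := Filtered {
  filtered_val :> F;
  filtered_valP : filtered_val \in val_ge g
}.
HB.instance Definition _ g := [isSub for @filtered_val g].
HB.instance Definition _ g := [Choice of filtered g by <:].
HB.instance Definition _ g := [SubChoice_isSubZmodule of filtered g by <:].

Definition val_gt g : {pred filtered g} := [pred x | Fin g < v (val x)].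

Lemma val_gt_zmod_closed g : zmod_closed (@val_gt g).
Proof.
split=> [|x y]; rewrite !inE ?val0 ?wlt_infty// => gx gy.
rewrite raddfB; apply: lt_le_trans (val_add v _ _).
by rewrite lt_min gx valN gy.
Qed.
HB.instance Definition _ g :=
  GRing.isZmodClosed.Build (filtered g) (@val_gt g) (@val_gt_zmod_closed g).

(* {x | g <= v x} / {x | g < v x} *)
Definition piece g := Quotient.quot (@val_gt g).
HB.instance Definition _ g := GRing.Zmodule.on (piece g).


(* The class of x; junk value 0 when v x < g. *)
Definition cls g x : piece g :=
  \pi_(Quotient.quot (@val_gt g)) (insubd (0 : filtered g) x).

Definition rep g (a : piece g) : F :=
  val (repr (a : Quotient.quot (@val_gt g))).

Lemma rep_ge g (a : piece g) : Fin g <= v (rep a).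
Proof. exact: (valP (repr (a : Quotient.quot (@val_gt g)))). Qed.

Lemma repK g (a : piece g) : cls g (rep a) = a.
Proof. by rewrite /cls /rep valKd reprK. Qed.

Lemma cls_eq g x y : Fin g <= v x -> Fin g <= v y ->
  (cls g x == cls g y) = (Fin g < v (x - y)).
Proof.
move=> gx gy; rewrite -[cls g x == _]Quotient.idealrBE inE raddfB /=.
by rewrite !insubdK.
Qed.

Lemma clsD g x y : Fin g <= v x -> Fin g <= v y ->
  cls g (x + y) = cls g x + cls g y.
Proof.
move=> gx gy; have gxy : Fin g <= v (x + y).
  by apply: le_trans (val_add v _ _); rewrite le_min gx.
rewrite /cls -[RHS](raddfD \pi_(Quotient.quot (@val_gt g))); congr (\pi _).
by apply: val_inj; rewrite raddfD /= !insubdK.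
Qed.

Lemma cls0 g : cls g 0 = 0.
Proof. by apply: (addIr (cls g 0)); rewrite -clsD ?val0 ?wlex1// !add0r. Qed.

Lemma val_mul_ge g h x y :
  Fin g <= v x -> Fin h <= v y -> Fin (g + h) <= v (x * y).
Proof.
rewrite val_mul; case: (v x) (v y) => [a|] [b|] //; exact: oag_leD.
Qed.

Lemma val_mul_gt g h x y :
  Fin g < v x -> Fin h <= v y -> Fin (g + h) < v (x * y).
Proof.
rewrite val_mul; case: (v x) (v y) => [a|] [b|] gx hy; try exact: wlt_infty.
by rewrite wltE; apply: oag_ltD => //; rewrite -wltE.
Qed.

Definition pmul g h (a : piece g) (b : piece h) : piece (g + h) :=
  cls (g + h) (rep a * rep b).

Lemma pmul_cls g h x y : Fin g <= v x -> Fin h <= v y ->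
  pmul (cls g x) (cls h y) = cls (g + h) (x * y).
Proof.
move=> gx hy; have gx' := rep_ge (cls g x); have hy' := rep_ge (cls h y).
apply/eqP; rewrite /pmul cls_eq ?val_mul_ge//.
have -> : rep (cls g x) * rep (cls h y) - x * y =
    (rep (cls h y) - y) * rep (cls g x) + (rep (cls g x) - x) * y.
  by rewrite !mulrBl [y * _]mulrC addrA subrK [rep _ * _]mulrC.
apply: lt_le_trans (val_add v _ _); rewrite lt_min; apply/andP; split.
  by rewrite addrC val_mul_gt// -cls_eq// repK.
by rewrite val_mul_gt// -cls_eq// repK.
Qed.

Lemma pmulDl g h (a b : piece g) (c : piece h) :
  pmul (a + b) c = pmul a c + pmul b c.
Proof.
rewrite -[a]repK -[b]repK -[c]repK -clsD ?rep_ge// !pmul_cls ?rep_ge//.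
  by rewrite mulrDl clsD ?val_mul_ge ?rep_ge.
by apply: le_trans (val_add v _ _); rewrite le_min !rep_ge.
Qed.

Lemma pmulDr g h (a : piece g) (b c : piece h) :
  pmul a (b + c) = pmul a b + pmul a c.
Proof.
rewrite -[a]repK -[b]repK -[c]repK -clsD ?rep_ge// !pmul_cls ?rep_ge//.
  by rewrite mulrDr clsD ?val_mul_ge ?rep_ge.
by apply: le_trans (val_add v _ _); rewrite le_min !rep_ge.
Qed.

Lemma piece_notin_value_group g (a : piece g) : ~ value_group v g -> a = 0.
Proof.
move=> ng; rewrite -[a]repK -(cls0 g); apply/eqP.
rewrite cls_eq ?rep_ge ?val0 ?wlex1// subr0 lt_neqAle rep_ge andbT.
by apply/eqP => vg; apply: ng; exists (rep a).
Qed.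

(* The index runs over the whole of G: the summands outside the value group are
   zero, by the previous lemma. *)
Definition gr : Type := dsum piece.
HB.instance Definition _ := GRing.Zmodule.on gr.

Definition hom g x : gr := dsingle (cls g x).

Lemma homD g x y : Fin g <= v x -> Fin g <= v y ->
  hom g (x + y) = hom g x + hom g y.
Proof. by move=> gx gy; rewrite /hom clsD// dsingle_add. Qed.

Lemma gr_ind (P : gr -> Prop) :
  P 0 -> (forall f1 f2, P f1 -> P f2 -> P (f1 + f2)) ->
  (forall g x, Fin g <= v x -> P (hom g x)) -> forall f, P f.
Proof.
move=> P0 PD P1; apply: dsum_ind => // g a.
by rewrite -[a]repK; apply: P1; apply: rep_ge.
Qed.

Definition gr_one : gr := hom 0 1.

Definition gr_mul (f1 f2 : gr) : gr :=
  dlift (fun g (a : piece g) =>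
    dlift (fun h (b : piece h) => dsingle (pmul a b) : gr) f2) f1.

Lemma gr_mulDr : right_distributive gr_mul +%R.
Proof.
move=> f f1 f2; rewrite /gr_mul {1 3 5}/dlift -big_split /=.
apply: eq_bigr => g _; rewrite dliftD// => h b c.
by rewrite pmulDr dsingle_add.
Qed.

Lemma gr_mulDl : left_distributive gr_mul +%R.
Proof.
move=> f1 f2 f; rewrite /gr_mul dliftD// => g a b.
rewrite /dlift -big_split /=; apply: eq_bigr => h _.
by rewrite pmulDl dsingle_add.
Qed.

Lemma gr_mul0 f : gr_mul f 0 = 0.
Proof. by apply: (addIr (gr_mul f 0)); rewrite -gr_mulDr !add0r. Qed.

Lemma gr_0mul f : gr_mul 0 f = 0.
Proof. by apply: (addIr (gr_mul 0 f)); rewrite -gr_mulDl !add0r. Qed.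

Lemma gr_mul_hom g h x y : Fin g <= v x -> Fin h <= v y ->
  gr_mul (hom g x) (hom h y) = hom (g + h) (x * y).
Proof.
move=> gx hy; rewrite /gr_mul dlift_single.
  rewrite dlift_single ?pmul_cls// => k b c.
  by rewrite pmulDr dsingle_add.
move=> k b c; rewrite /dlift -big_split /=; apply: eq_bigr => l _.
by rewrite pmulDl dsingle_add.
Qed.

Lemma gr_mulC : commutative gr_mul.
Proof.
elim/gr_ind => [f|f1 f2 IH1 IH2 f|g x gx]; first by rewrite gr_mul0 gr_0mul.
  by rewrite gr_mulDl gr_mulDr IH1 IH2.
elim/gr_ind => [|f1 f2 IH1 IH2|h y hy]; first by rewrite gr_mul0 gr_0mul.
  by rewrite gr_mulDl gr_mulDr IH1 IH2.
by rewrite !gr_mul_hom// addrC mulrC.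
Qed.

Lemma gr_mulA : associative gr_mul.
Proof.
elim/gr_ind => [f f'|f1 f2 IH1 IH2 f f'|g x gx].
- by rewrite !gr_0mul.
- by rewrite !gr_mulDl IH1 IH2.
elim/gr_ind => [f|f1 f2 IH1 IH2 f|h y hy].
- by rewrite !(gr_0mul, gr_mul0).
- by rewrite !(gr_mulDl, gr_mulDr) IH1 IH2.
elim/gr_ind => [|f1 f2 IH1 IH2|k z kz].
- by rewrite !gr_mul0.
- by rewrite !gr_mulDr IH1 IH2.
by rewrite !gr_mul_hom ?val_mul_ge// addrA mulrA.
Qed.

Lemma gr_mul1 : left_id gr_one gr_mul.
Proof.
elim/gr_ind => [|f1 f2 IH1 IH2|h y hy]; first by rewrite gr_mul0.
  by rewrite gr_mulDr IH1 IH2.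
by rewrite gr_mul_hom ?val1// add0r mul1r.
Qed.

Lemma gr_one_neq0 : gr_one != 0.
Proof.
apply/eqP => /(congr1 (fun f : gr => f 0)); rewrite /gr_one /hom dsingle_eq.
rewrite -[RHS](cls0 0) => /eqP.
by rewrite cls_eq ?val1 ?val0 ?wlex1// subr0 val1 ltxx.
Qed.

HB.instance Definition _ := GRing.Zmodule_isComNzRing.Build gr
  gr_mulA gr_mulC gr_mul1 gr_mulDl gr_one_neq0.

Lemma homM g h x y : Fin g <= v x -> Fin h <= v y ->
  hom g x * hom h y = hom (g + h) (x * y).
Proof. exact: gr_mul_hom. Qed.

(* The initial form of x != 0; junk value 0 at x = 0. *)
Definition ini x : gr := if v x is Fin g then hom g x else 0.

Lemma iniM x y : ini x * ini y = ini (x * y).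
Proof.
rewrite /ini val_mul; case vx: (v x) => [g|]; last by rewrite mul0r.
case vy: (v y) => [h|]; last by rewrite mulr0.
by rewrite homM ?vx ?vy.
Qed.

End GradedRing.

Section GradedModule.
Variables (K : fieldType) (L : extFieldType K) (G : oagType).
Variable v : valuation L G.
Local Notation vK := (val_res K v).

(* The embedding of G_v(K) into G_v(L) sending the class of k to that of k%:A. *)
Definition gr_in_alg (c : gr vK) : gr v :=
  dlift (fun g (a : piece vK g) => hom v g (rep a)%:A) c.

Lemma gr_in_alg_pieceD g : {morph (fun a : piece vK g => hom v g (rep a)%:A) :
  a b / a + b}.
Proof.
move=> a b; have rab : Fin g <= vK (rep a + rep b).
  by apply: le_trans (val_add vK _ _); rewrite le_min !rep_ge.
rewrite -homD ?(rep_ge a) ?(rep_ge b)// -scalerDl; congr dsingle; apply/eqP.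
rewrite cls_eq ?(rep_ge (a + b)) -?scalerBl//.
by rewrite -[v _]/(vK _) -cls_eq ?rep_ge// clsD ?rep_ge// !repK.
Qed.

Lemma gr_in_algD : {morph gr_in_alg : c d / c + d}.
Proof. exact: dliftD gr_in_alg_pieceD. Qed.

Lemma gr_in_alg0 : gr_in_alg 0 = 0.
Proof. by apply: (addIr (gr_in_alg 0)); rewrite -gr_in_algD !add0r. Qed.

Lemma gr_in_alg_hom g (k : K) : Fin g <= vK k ->
  gr_in_alg (hom vK g k) = hom v g k%:A.
Proof.
move=> gk; rewrite /gr_in_alg dlift_single; last exact: gr_in_alg_pieceD.
congr dsingle; apply/eqP; rewrite cls_eq ?(rep_ge (cls vK g k))// -scalerBl.
by rewrite -[v _]/(vK _) -cls_eq ?rep_ge// repK.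
Qed.

Lemma gr_in_alg1 : gr_in_alg 1 = 1.
Proof. by rewrite [LHS]gr_in_alg_hom ?val1// scale1r. Qed.

Lemma gr_in_algM : {morph gr_in_alg : c d / c * d}.
Proof.
elim/gr_ind => [d|c1 c2 IH1 IH2 d|g k gk].
- by rewrite mul0r gr_in_alg0 mul0r.
- by rewrite mulrDl !gr_in_algD IH1 IH2 mulrDl.
elim/gr_ind => [|d1 d2 IH1 IH2|h k' hk'].
- by rewrite mulr0 gr_in_alg0 mulr0.
- by rewrite mulrDr !gr_in_algD IH1 IH2 mulrDr.
rewrite homM// !gr_in_alg_hom ?val_mul_ge// homM//.
by rewrite mulr_algl scalerA.
Qed.

Lemma gr_in_alg_ini (k : K) : gr_in_alg (ini vK k) = ini v k%:A.
Proof.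
rewrite /ini; case vk: (vK k) => [g|]; move: (vk) => /= ->.
  by rewrite gr_in_alg_hom ?vk.
exact: gr_in_alg0.
Qed.
End GradedModule.

(* G_v(L) seen as a G_v(K)-module. *)
Definition gr_over (K : fieldType) (L : extFieldType K) (G : oagType)
  (v : valuation L G) : Type := gr v.

Section GradedModuleInstance.
Variables (K : fieldType) (L : extFieldType K) (G : oagType).
Variable v : valuation L G.

HB.instance Definition _ := GRing.Zmodule.on (gr_over v).

Definition gr_scale (c : gr (val_res K v)) (f : gr_over v) : gr_over v :=
  gr_in_alg c * (f : gr v).

Lemma gr_scaleA c d f : gr_scale c (gr_scale d f) = gr_scale (c * d) f.
Proof. by rewrite /gr_scale gr_in_algM mulrA. Qed.
Lemma gr_scale1 : left_id 1 gr_scale.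
Proof. by move=> f; rewrite /gr_scale gr_in_alg1 mul1r. Qed.
Lemma gr_scaleDr : right_distributive gr_scale +%R.
Proof. by move=> c f1 f2; rewrite /gr_scale mulrDr. Qed.
Lemma gr_scaleDl f : {morph gr_scale^~ f : c d / c + d}.
Proof. by move=> c d; rewrite /gr_scale gr_in_algD mulrDl. Qed.

HB.instance Definition _ :=
  GRing.Zmodule_isLmodule.Build (gr (val_res K v)) (gr_over v)
    gr_scaleA gr_scale1 gr_scaleDr gr_scaleDl.

Lemma gr_scale_ini (k : K) (x : L) :
  ini (val_res K v) k *: (ini v x : gr_over v) = ini v (k *: x).
Proof.
by rewrite -mulr_algl -iniM -gr_in_alg_ini.
Qed.
End GradedModuleInstance.

Section FreeFamilies.
Variables (R : pzRingType) (V : lmodType R) (n : nat).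
Implicit Types (e : 'I_n -> V) (M : set V).

Definition lin_indep e :=
  forall c : 'I_n -> R, \sum_i c i *: e i = 0 -> forall i, c i = 0.

Definition lin_span e : set V :=
  [set w | exists c : 'I_n -> R, w = \sum_i c i *: e i].

Definition is_basis M e := lin_indep e /\ lin_span e = M.
End FreeFamilies.

Definition has_dim (R : pzRingType) (V : lmodType R) (n : nat) :=
  exists e : 'I_n -> V, is_basis [set: V] e.

Definition fin_gen (R : pzRingType) (V : lmodType R) (M : set V) :=
  exists n (e : 'I_n -> V), M = lin_span e.

Section Separated.
Variables (K : fieldType) (L : extFieldType K) (G : oagType).
Variable v : valuation L G.

Definition separated_family n (l : 'I_n -> L) := forall x : 'I_n -> K,
  v (\sum_i x i *: l i) = \big[Order.min/Infty]_i v (x i *: l i).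

(* Maximality is meant among families of nonzero elements: appending 0 to a
   separated family always gives a separated family. *)
Definition maximal_separated_family n (l : 'I_n -> L) :=
  [/\ forall i, l i != 0, separated_family l &
      forall m (l' : 'I_m -> L) (f : 'I_n -> 'I_m), injective f ->
        (forall i, l' (f i) = l i) -> (forall j, l' j != 0) ->
        separated_family l' -> bijective f].

Definition vs_defectless := forall M : set L, fin_gen M ->
  exists n (b : 'I_n -> L), is_basis M b /\ separated_family b.
End Separated.

(* Main.v *)
(* In degree g, a relation between the initial forms of the l_i says precisely
   that some combination of the l_i has value larger than all its terms; this
   gives the first part. If l is maximal separated, each x <> 0 is approximated
   by some combination y of the l_i with v x < v (x - y), so its initial form is
   a combination of those of the l_i. For the last part, a maximal separated
   family has [L : K] elements as soon as G_v(L) has rank [L : K], because ranks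
   of free modules over a nontrivial commutative ring are unique; and a subspace
   of a space with a separated basis has one too, by Gaussian elimination that
   takes as pivot of a vector a coordinate carrying its value. *)
Require Import Defs.
From HB Require Import structures.
From mathcomp Require Import all_boot all_order all_algebra.
From mathcomp Require Import boolp classical_sets cardinality.

Set Implicit Arguments.
Unset Strict Implicit.
Unset Printing Implicit Defensive.

Import Order.TTheory GRing.Theory.
Local Open Scope classical_set_scope.
Local Open Scope ring_scope.

(* MathComp's [vector] also exports a constant [hom]. *)
Local Notation hom := Defs.hom.

(** * Values of sums, and sums of homogeneous elements *)

Section ValuationSums.
Variables (F : fieldType) (G : oagType) (v : valuation F G).
Implicit Types (g : G) (w : withtop G).

Lemma val_sum_ge w (I : Type) (r : seq I) (E : I -> F) :
  (forall i, w <= v (E i)) -> w <= v (\sum_(i <- r) E i).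
Proof.
move=> wE; elim/big_ind: _ => // [|x y wx wy]; first by rewrite val0 wlex1.
by apply: le_trans (val_add v _ _); rewrite le_min wx.
Qed.

Lemma val_sub_ge w x y : w <= v x -> w <= v y -> w <= v (x - y).
Proof.
by move=> wx wy; apply: le_trans (val_add v _ _); rewrite le_min wx valN.
Qed.

Lemma val_addl_le x y : v (x + y) <= v x -> v (x + y) <= v y.
Proof.
by move=> /(val_sub_ge (lexx _)); rewrite [x + y - x]addrC addKr.
Qed.

Lemma hom_eq0 g x : Fin g <= v x -> hom v g x = 0 -> Fin g < v x.
Proof.
move=> gx /(congr1 (fun f : gr v => f g)).
rewrite /hom dsingle_eq dsum0E -(cls0 v g) => /eqP.
by rewrite cls_eq ?val0 ?wlex1// subr0.
Qed.

Lemma hom_eq g x y : Fin g <= v x -> Fin g <= v y -> Fin g < v (x - y) ->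
  hom v g x = hom v g y.
Proof.
by move=> gx gy gxy; rewrite /hom; congr dsingle; apply/eqP; rewrite cls_eq.
Qed.

Lemma hom0 g : hom v g 0 = 0.
Proof. by rewrite /hom cls0 dsingle0. Qed.

Lemma hom_sum g (I : Type) (r : seq I) (E : I -> F) :
  (forall i, Fin g <= v (E i)) ->
  hom v g (\sum_(i <- r) E i) = \sum_(i <- r) hom v g (E i).
Proof.
move=> gE; elim: r => [|i r IH]; first by rewrite !big_nil hom0.
by rewrite !big_cons homD ?IH// val_sum_ge.
Qed.

Lemma ini_hom g x : v x = Fin g -> ini v x = hom v g x.
Proof. by rewrite /ini => ->. Qed.
End ValuationSums.

(** * Homogeneous components of scalar multiples *)

Section GradedScaling.
Variables (K : fieldType) (L : extFieldType K) (G : oagType).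
Variable v : valuation L G.
Local Notation vK := (val_res K v).

Lemma val_scale (k : K) (x : L) : v (k *: x) = vK k + v x.
Proof. by rewrite -mulr_algl val_mul. Qed.

Lemma val_scale_infty (k : K) (x : L) : x != 0 -> Infty <= v (k *: x) -> k = 0.
Proof.
move=> x0; have : (v (k *: x) == Infty) = (k == 0).
  by rewrite val_eq_infty scaler_eq0 (negPf x0) orbF.
by case: (v _) => //; rewrite eqxx => /esym/eqP.
Qed.

Lemma hom_scale (g h : G) (k : K) (x : L) : Fin g <= vK k -> Fin h <= v x ->
  hom vK g k *: (hom v h x : gr_over v) = hom v (g + h) (k *: x).
Proof.
move=> gk hx; rewrite -[LHS]/(gr_in_alg _ * _) gr_in_alg_hom// homM//.
by rewrite mulr_algl.
Qed.

Lemma cls_sum g (I : Type) (r : seq I) (E : I -> L) :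
  (forall i, Fin g <= v (E i)) ->
  cls v g (\sum_(i <- r) E i) = \sum_(i <- r) cls v g (E i).
Proof.
move=> gE; elim: r => [|i r IH]; first by rewrite !big_nil cls0.
by rewrite !big_cons clsD ?IH// val_sum_ge.
Qed.

Lemma val_scale_ge (g h : G) (k : K) (x : L) :
  v x = Fin h -> (Fin (g - h) <= vK k) = (Fin g <= v (k *: x)).
Proof.
rewrite val_scale => ->; case: (vK k) => //= a; rewrite !wleE.
by rewrite -(oag_leD2r h) subrK.
Qed.

Lemma val_scale_gt (g h : G) (k : K) (x : L) :
  v x = Fin h -> (Fin (g - h) < vK k) = (Fin g < v (k *: x)).
Proof.
rewrite val_scale => ->; case: (vK k) => [a|] /=; last by rewrite !wlt_infty.
by rewrite !wltE -(oag_ltD2r h) subrK.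
Qed.

(** Scaling [x] by [k - k'] shifts the value of [k - k'] by exactly [h], so strict inequalities are
    preserved both ways. *)
Lemma cls_scale (g h : G) (k k' : K) (x : L) : v x = Fin h ->
  Fin (g - h) <= vK k -> Fin (g - h) <= vK k' ->
  (cls v g (k *: x) == cls v g (k' *: x)) =
  (cls vK (g - h) k == cls vK (g - h) k').
Proof.
move=> vx gk gk'; rewrite !cls_eq// -?(val_scale_ge _ _ vx)//.
by rewrite -scalerBl (val_scale_gt _ _ vx).
Qed.

(** By additivity [c] may be taken homogeneous; [cls_scale] shows that the choice of representative
    does not matter. *)
Lemma scale_hom_comp (c : gr vK) (g h : G) (x : L) : v x = Fin h ->
  (c *: (hom v h x : gr_over v) : gr v) g = cls v g (rep (c (g - h)) *: x).
Proof.
move=> vx.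
have rep0 : cls v g (rep (0 : piece vK (g - h)) *: x) = 0.
  rewrite -(cls0 v g) -[X in _ = cls v g X](scale0r x); apply/eqP.
  by rewrite (cls_scale vx) ?rep_ge ?val0 ?wlex1// repK cls0.
elim/gr_ind: c => [|c1 c2 IH1 IH2|a k ak].
- by rewrite scale0r rep0.
- rewrite scalerDl dsumDE IH1 IH2 -clsD -?(val_scale_ge _ _ vx) ?rep_ge//.
  rewrite -scalerDl; apply/eqP; rewrite (cls_scale vx) ?rep_ge//.
    by rewrite clsD ?rep_ge// !repK.
  by apply: le_trans (val_add vK _ _); rewrite le_min !rep_ge.
rewrite hom_scale ?vx//; have [<-|ne] := eqVneq (a + h) g.
  rewrite [in RHS]addrK /hom !dsingle_eq; apply/eqP.
  by rewrite (cls_scale vx) ?addrK ?rep_ge// repK.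
rewrite /hom !dsingle_neq//.
by apply: contraNneq ne => ->; rewrite subrK.
Qed.
End GradedScaling.

(** * Separation and independence of initial forms *)

Section Separated.
Variables (K : fieldType) (L : extFieldType K) (G : oagType).
Variable v : valuation L G.
Local Notation vK := (val_res K v).

(** A sum always has value at least the minimum over its terms, so only the opposite bound has
    content. *)
Lemma separatedP n (l : 'I_n -> L) : separated_family v l <->
  forall (x : 'I_n -> K) i, v (\sum_j x j *: l j) <= v (x i *: l i).
Proof.
split=> [sl x i|sl x]; first by rewrite sl; apply: bigmin_le_cond.
apply/le_anti/andP; split.
  by apply/bigmin_geP; split; [exact: wlex1|move=> i _; exact: sl].
by apply: val_sum_ge => i; apply: bigmin_le_cond.
Qed.

Lemma separated_lin_indep_ini n (l : 'I_n -> L) : (forall i, l i != 0) ->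
  separated_family v l -> lin_indep (fun i => ini v (l i) : gr_over v).
Proof.
move=> l0 /separatedP sl c c0 i; apply: dsumP => g.
have [a va] := choice (fun i => val_finite v (l0 i)).
(* The relation is read in degree [g + a i], where [c i] contributes through its component in degree
   [g], and [c j] through that in degree [g + a i - a j]. *)
pose x j := rep (c j (g + a i - a j)).
have xge j : Fin (g + a i) <= v (x j *: l j).
  by rewrite -(val_scale_ge _ _ (va j)) rep_ge.
have : Fin (g + a i) < v (\sum_j x j *: l j).
  apply: hom_eq0; first exact: val_sum_ge.
  rewrite /hom cls_sum// -[RHS](dsingle0 _ (g + a i)); congr dsingle.
  transitivity ((\sum_j c j *: (ini v (l j) : gr_over v) : gr v) (g + a i)).
    rewrite [RHS]dsum_sumE; apply: eq_bigr => j _.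
    by rewrite (ini_hom (va j)) (scale_hom_comp _ _ (va j)).
  by rewrite c0.
move=> /lt_le_trans/(_ (sl x i)); rewrite -(val_scale_gt _ _ (va i)).
rewrite /x addrK dsum0E => gr0.
rewrite -[LHS]repK -[RHS](cls0 vK g); apply/eqP.
by rewrite cls_eq ?val0 ?wlex1 ?rep_ge// subr0.
Qed.

(** If a sum exceeds one of its terms, its terms of least value [g] cancel in degree [g], which is a
    relation among the initial forms. *)
Lemma lin_indep_ini_separated n (l : 'I_n -> L) : (forall i, l i != 0) ->
  lin_indep (fun i => ini v (l i) : gr_over v) -> separated_family v l.
Proof.
move=> l0 il; apply/separatedP => x i.
have [a va] := choice (fun i => val_finite v (l0 i)).
rewrite leNgt; apply/negP => lt_i.
case: (@arg_minP _ _ _ i xpredT (fun j => v (x j *: l j)) isT) => j _ jmin.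
have [g vg] : exists g, v (x j *: l j) = Fin g.
  case vj: (v (x j *: l j)) => [g|]; first by exists g.
  by have := le_lt_trans (jmin i isT) lt_i; rewrite vj ltNge wlex1.
have gx k : Fin g <= v (x k *: l k) by rewrite -vg; apply: jmin.
have gS : Fin g < v (\sum_k x k *: l k) by apply: le_lt_trans lt_i; apply: gx.
(* Independence kills the coefficient at [j], although [x j *: l j] has value exactly [g]. *)
have : hom vK (g - a j) (x j) = 0.
  apply: (il (fun k => hom vK (g - a k) (x k))).
  transitivity (hom v g (\sum_k x k *: l k)).
    rewrite hom_sum//; apply: eq_bigr => k _.
    by rewrite (ini_hom (va k)) hom_scale ?va ?subrK// (val_scale_ge _ _ (va k)).
  by rewrite -(hom0 v g); apply: hom_eq; rewrite ?val0 ?wlex1 ?subr0// ltW.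
move/hom_eq0; rewrite (val_scale_ge _ _ (va j)) (val_scale_gt _ _ (va j)).
by rewrite vg ltxx lexx => /(_ isT).
Qed.
End Separated.

(** * Families, spans and uniqueness of rank *)

Definition fcons (T : Type) n (x : T) (l : 'I_n -> T) (j : 'I_n.+1) : T :=
  if unlift ord0 j is Some i then l i else x.

Lemma fcons0 (T : Type) n (x : T) (l : 'I_n -> T) : fcons x l ord0 = x.
Proof. by rewrite /fcons unlift_none. Qed.

Lemma fcons_lift (T : Type) n (x : T) (l : 'I_n -> T) i :
  fcons x l (lift ord0 i) = l i.
Proof. by rewrite /fcons liftK. Qed.

Lemma fcons_forall (T : Type) (P : T -> Prop) n (x : T) (l : 'I_n -> T) :
  P x -> (forall i, P (l i)) -> forall j, P (fcons x l j).
Proof. by move=> Px Pl j; rewrite /fcons; case: unlift. Qed.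

Section Spans.
Variables (R : pzRingType) (V : lmodType R).

Lemma lin_span_gen n (e : 'I_n -> V) i : lin_span e (e i).
Proof.
exists (fun j => (j == i)%:R); rewrite (bigD1 i)//= eqxx scale1r big1 ?addr0//.
by move=> j /negPf ->; rewrite scale0r.
Qed.

Lemma lin_spanD n (e : 'I_n -> V) x y :
  lin_span e x -> lin_span e y -> lin_span e (x + y).
Proof.
move=> [c ->] [d ->]; exists (fun i => c i + d i).
by rewrite -big_split; apply: eq_bigr => i _; rewrite scalerDl.
Qed.

Lemma lin_spanZ n (e : 'I_n -> V) a x : lin_span e x -> lin_span e (a *: x).
Proof.
move=> [c ->]; exists (fun i => a * c i).
by rewrite scaler_sumr; apply: eq_bigr => i _; rewrite scalerA.
Qed.

Lemma lin_span0 n (e : 'I_n -> V) : lin_span e 0.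
Proof. by exists (fun=> 0); rewrite big1// => i _; rewrite scale0r. Qed.

Lemma lin_span_subset m n (e : 'I_m -> V) (e' : 'I_n -> V) :
  (forall i, lin_span e' (e i)) -> lin_span e `<=` lin_span e'.
Proof.
move=> ee' _ [c ->]; elim/big_ind: _ => [|x y ex ey|i _].
- exact: lin_span0.
- exact: lin_spanD.
- exact: lin_spanZ.
Qed.

Lemma lin_span_coef m n (e : 'I_m -> V) (e' : 'I_n -> V) :
  (forall i, lin_span e' (e i)) ->
  exists A : 'M[R]_(m, n), forall i, e i = \sum_j A i j *: e' j.
Proof.
move=> /choice[c ec]; exists (\matrix_(i, j) c i j) => i.
by rewrite ec; apply: eq_bigr => j _; rewrite mxE.
Qed.

Lemma lin_span_coef_mul m n p (e : 'I_n -> V) (e' : 'I_p -> V)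
    (A : 'M[R]_(m, n)) (B : 'M[R]_(n, p)) :
  (forall i, e i = \sum_j B i j *: e' j) ->
  forall k, \sum_i A k i *: e i = \sum_j (A *m B) k j *: e' j.
Proof.
move=> eB k; under eq_bigr do rewrite eB scaler_sumr.
rewrite exchange_big; apply: eq_bigr => j _; rewrite mxE scaler_suml.
by apply: eq_bigr => i _; rewrite scalerA.
Qed.

Lemma lin_indep_inj n (e : 'I_n -> V) m (A B : 'M[R]_(m, n)) : lin_indep e ->
  (forall k, \sum_i A k i *: e i = \sum_i B k i *: e i) -> A = B.
Proof.
move=> ie AB; apply/matrixP => k i; apply/eqP; rewrite -subr_eq0; apply/eqP.
apply: (ie (fun i => A k i - B k i)).
under eq_bigr do rewrite scalerBl.
by rewrite sumrB AB subrr.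
Qed.
End Spans.

Lemma lin_indep_neq0 (R : nzRingType) (V : lmodType R) n (e : 'I_n -> V) i :
  lin_indep e -> e i != 0.
Proof.
move=> ie; apply/eqP => ei0.
have : \sum_j (j == i)%:R *: e j = 0.
  rewrite big1// => j _.
  by case: eqP => [->|_]; rewrite ?ei0 ?scaler0 ?scale0r.
by move=> /ie/(_ i)/eqP; rewrite eqxx oner_eq0.
Qed.

(** Writing each basis in the other gives [A *m B = 1%:M], which forces [m <= n] over a nontrivial
    commutative ring. *)
Lemma is_basis_leq (R : comNzRingType) (V : lmodType R) m n
    (e : 'I_m -> V) (e' : 'I_n -> V) :
  is_basis [set: V] e -> is_basis [set: V] e' -> (m <= n)%N.
Proof.
move=> [ie se] [_ se'].
have [A eA] : exists A : 'M[R]_(m, n), forall i, e i = \sum_j A i j *: e' j.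
  by apply: lin_span_coef => i; rewrite se'.
have [B eB] : exists B : 'M[R]_(n, m), forall i, e' i = \sum_j B i j *: e j.
  by apply: lin_span_coef => i; rewrite se.
apply: (@mulmx1_min _ _ _ A B); apply: (lin_indep_inj ie) => k.
rewrite -(lin_span_coef_mul _ eB) -eA -[LHS]scale1r.
rewrite (bigD1 k)//= mxE eqxx big1 ?addr0// => i ik.
by rewrite mxE eq_sym (negPf ik) scale0r.
Qed.

Lemma is_basis_size (R : comNzRingType) (V : lmodType R) m n
    (e : 'I_m -> V) (e' : 'I_n -> V) :
  is_basis [set: V] e -> is_basis [set: V] e' -> m = n.
Proof.
move=> be be'; apply/eqP.
by rewrite eqn_leq (is_basis_leq be be') (is_basis_leq be' be).
Qed.

(** * Linear independence over a field *)

Section VectorSpaces.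
Variables (K : fieldType) (V : lmodType K).

(** A row vector in the kernel of [A] is a relation among the [e i]. *)
Lemma lin_indep_row_free m n (e : 'I_m -> V) (e' : 'I_n -> V)
    (A : 'M[K]_(m, n)) :
  lin_indep e -> (forall i, e i = \sum_j A i j *: e' j) -> row_free A.
Proof.
move=> ie eA; rewrite -kermx_eq0; apply/eqP; apply: (lin_indep_inj ie) => k.
rewrite (lin_span_coef_mul _ eA) mulmx_ker !big1// => i _;
  by rewrite mxE scale0r.
Qed.

Lemma lin_indep_leq m n (e : 'I_m -> V) (e' : 'I_n -> V) :
  lin_indep e -> (forall i, lin_span e' (e i)) -> (m <= n)%N.
Proof.
move=> ie /lin_span_coef[A /(lin_indep_row_free ie)/eqP <-].
exact: rank_leq_col.
Qed.

(** The square coefficient matrix is row free, hence invertible, and its inverse writes [e'] in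
    terms of [e]. *)
Lemma lin_indep_basis n (e e' : 'I_n -> V) :
  is_basis [set: V] e' -> lin_indep e -> is_basis [set: V] e.
Proof.
move=> [_ se'] ie; split=> //.
have [A eA] : exists A : 'M[K]_n, forall i, e i = \sum_j A i j *: e' j.
  by apply: lin_span_coef => i; rewrite se'.
have uA : A \in unitmx by rewrite -row_free_unit (lin_indep_row_free ie eA).
apply/seteqP; split=> // w _; have : lin_span e' w by rewrite se'.
apply: lin_span_subset => k; exists (invmx A k).
rewrite (lin_span_coef_mul _ eA) mulVmx// (bigD1 k)//= mxE eqxx scale1r.
by rewrite big1 ?addr0// => i ik; rewrite mxE eq_sym (negPf ik) scale0r.
Qed.
End VectorSpaces.

(** * Maximal separated families *)

Section MaximalSeparated.
Variables (K : fieldType) (L : extFieldType K) (G : oagType).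
Variable v : valuation L G.
Local Notation vK := (val_res K v).

Lemma separated_lin_indep n (l : 'I_n -> L) : (forall i, l i != 0) ->
  separated_family v l -> lin_indep l.
Proof.
move=> l0 /separatedP sl c c0 i; have := sl c i.
by rewrite c0 val0 => /val_scale_infty; apply.
Qed.

(** Prepending [x] breaks separation. In a combination [a *: x + S] that shows this, [a *: x] itself
    lies below the sum; dividing by [a] gives the approximation. *)
Lemma maximal_separated_approx n (l : 'I_n -> L) (x : L) :
  maximal_separated_family v l -> x != 0 ->
  exists z : 'I_n -> K, v x < v (x - \sum_i z i *: l i).
Proof.
move=> [l0 sl ml] x0.
have : ~ separated_family v (fcons x l).
  move=> /(ml _ _ (lift ord0) lift_inj (fcons_lift x l)).
  move=> /(_ (@fcons_forall _ (fun y => y != 0) _ _ _ x0 l0))/bij_eq_card.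
  rewrite !card_ord.
  by move/eqP; rewrite ltn_eqF.
move/separatedP: sl => sl.
move=> /separatedP/existsNP[y /existsNP[j /negP]]; rewrite -ltNge.
rewrite big_ord_recl fcons0.
under eq_bigr do rewrite fcons_lift.
set a := y ord0; set S := \sum_i _ => ltS.
(* Otherwise [S] too has at least the value of the sum, and so have all its terms by separation of
   [l], against [ltS]. *)
have axS : v (a *: x) < v (a *: x + S).
  rewrite ltNge; apply/negP => ge; move: ltS; apply/negP; rewrite -leNgt.
  have leS := val_addl_le ge.
  case: (unliftP ord0 j) => [k ->|->]; last by rewrite fcons0.
  by rewrite fcons_lift; apply: le_trans leS (sl _ k).
have a0 : a != 0.
  apply: contraTneq axS => ->; rewrite scale0r val0.
  by rewrite -leNgt wlex1.
exists (fun i => - (a^-1 * y (lift ord0 i))).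
rewrite -sumrN; under eq_bigr do rewrite -scaleNr opprK -scalerA.
rewrite -scaler_sumr -/S -{2}[x](scalerK a0) -scalerDr -{1}[x](scalerK a0).
(* Both sides are translated by the finite value of [a^-1]. *)
rewrite !(val_scale _ a^-1).
have [g ->] := val_finite vK (invr_neq0 a0).
case: (v (a *: x)) axS => [b|]; last by rewrite ltNge wlex1.
case: (v _) => [c|]; rewrite ?wlt_infty// !wltE.
by rewrite ![g + _]addrC oag_ltD2r.
Qed.

Lemma maximal_separated_span n (l : 'I_n -> L) :
  maximal_separated_family v l ->
  lin_span (fun i => ini v (l i) : gr_over v) = [set: gr_over v].
Proof.
move=> ml; apply/seteqP; split=> // f _.
elim/gr_ind: f => [|f1 f2 IH1 IH2|g x gx]; first exact: lin_span0.
  exact: lin_spanD.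
have [gltx|xleg] := ltP (Fin g) (v x).
  have -> : hom v g x = 0.
    by rewrite -(hom0 v g); apply: hom_eq; rewrite ?val0 ?wlex1 ?subr0.
  exact: lin_span0.
have vx : v x = Fin g by apply/le_anti; rewrite xleg.
have x0 : x != 0 by rewrite -(val_eq_infty v) vx.
have [z ltz] := maximal_separated_approx ml x0.
case: ml => l0 /separatedP sl _.
have [a va] := choice (fun i => val_finite v (l0 i)).
(* The sum is [x] minus an element of value above [g], so its value is at least [g]; separation
   passes this on to the terms. *)
have zge i : Fin g <= v (z i *: l i).
  apply: le_trans (sl z i); set S := \sum_i _ in ltz *.
  by rewrite -[S](subKr x) val_sub_ge// -vx ltW.
exists (fun i => hom vK (g - a i) (z i)).
have -> : hom v g x = hom v g (\sum_i z i *: l i).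
  by apply: hom_eq => //; [exact: val_sum_ge|rewrite -vx].
rewrite hom_sum//; apply: eq_bigr => i _.
by rewrite (ini_hom (va i)) hom_scale ?va ?subrK// (val_scale_ge _ _ (va i)).
Qed.

Lemma separated_maximal n (l : 'I_n -> L) : (forall i, l i != 0) ->
  separated_family v l ->
  (forall m (l' : 'I_m -> L), (forall i, l' i != 0) ->
    separated_family v l' -> (m <= n)%N) ->
  maximal_separated_family v l.
Proof.
move=> l0 sl ml; split=> // m l' f fi _ l'0 sl'; apply: inj_card_bij => //.
by rewrite !card_ord (ml _ l').
Qed.

Lemma separated_size_leq d (e : 'I_d -> L) m (l : 'I_m -> L) :
  is_basis [set: L] e -> (forall i, l i != 0) -> separated_family v l ->
  (m <= d)%N.
Proof.
move=> [_ se] l0 sl; apply: (@lin_indep_leq _ _ _ _ l e).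
  exact: separated_lin_indep.
by move=> i; rewrite se.
Qed.

(** Sizes of separated families of nonzero elements are bounded by [d], and a family of largest size
    is maximal. *)
Lemma exists_maximal_separated d : has_dim L d ->
  exists n (l : 'I_n -> L), maximal_separated_family v l.
Proof.
move=> [e be].
pose P n := `[< exists l : 'I_n -> L,
  (forall i, l i != 0) /\ separated_family v l >].
have P0 : exists n, P n.
  exists 0%N; apply/asboolP; exists (fun=> 0); split; first by case.
  by apply/separatedP => x [].
have Pd n : P n -> (n <= d)%N.
  by move=> /asboolP[l [l0 sl]]; apply: separated_size_leq be l0 sl.
case: (ex_maxnP P0 Pd) => n /asboolP[l [l0 sl]] maxn.
exists n, l; apply: separated_maximal => // m l' l'0 sl'.
by apply: maxn; apply/asboolP; exists l'.
Qed.
End MaximalSeparated.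

(** * Gaussian elimination with pivots of least value *)

Section GramSchmidt.
Variables (K : fieldType) (L : extFieldType K) (G : oagType).
Variable v : valuation L G.
Variables (d : nat) (l : 'I_d -> L).
Hypothesis l0 : forall i, l i != 0.
Hypothesis sl : separated_family v l.
Implicit Types u : 'rV[K]_d.

(** Elimination works on coordinate rows, which this map carries injectively into [L]. *)
Definition lincomb (u : 'rV[K]_d) : L := \sum_j u 0 j *: l j.

Lemma lincombD a u w : lincomb (a *: u + w) = a *: lincomb u + lincomb w.
Proof.
rewrite /lincomb scaler_sumr -big_split; apply: eq_bigr => i _ /=.
by rewrite !mxE scalerDl scalerA.
Qed.

HB.instance Definition _ := GRing.isLinear.Build K 'rV[K]_d L _ lincomb lincombD.

Lemma lincomb_sum p (c : 'I_p -> K) (b : 'I_p -> 'rV[K]_d) :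
  lincomb (\sum_k c k *: b k) = \sum_k c k *: lincomb (b k).
Proof. by rewrite [LHS]raddf_sum; apply: eq_bigr => k _; apply: linearZ. Qed.

Lemma lincomb_eq0 u : lincomb u = 0 -> u = 0.
Proof.
move=> u0; apply/rowP => i; rewrite mxE.
exact: (separated_lin_indep l0 sl u0).
Qed.

Lemma val_lincomb_le u i : v (lincomb u) <= v (u 0 i *: l i).
Proof. by move/separatedP: sl => /(_ (u 0)). Qed.

(** The index is one whose term has least value; a zero coefficient there would give all terms value
    [Infty]. *)
Lemma pivot u : u != 0 ->
  exists2 i, u 0 i != 0 & v (u 0 i *: l i) <= v (lincomb u).
Proof.
move=> /rV0Pn[j uj].
case: (@arg_minP _ _ _ j xpredT (fun j => v (u 0 j *: l j)) isT) => i _ imin.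
exists i; last by apply: val_sum_ge => k; apply: imin.
apply: contraNneq uj => ui; have := imin j isT.
by rewrite ui scale0r val0 => /val_scale_infty-> .
Qed.

(* The [i]-th coordinate of [a *: u + w], with [w] in the span of [b], is that
   of [a *: u], so the sum has value at most that of [a *: u]. *)
Lemma separated_cons u i p (b : 'I_p -> 'rV[K]_d) :
  v (u 0 i *: l i) <= v (lincomb u) -> (forall k, b k 0 i = 0) ->
  separated_family v (fun k => lincomb (b k)) ->
  separated_family v (fun k => lincomb (fcons u b k)).
Proof.
move=> ui bi /separatedP sb; apply/separatedP => x.
rewrite big_ord_recl fcons0.
under eq_bigr do rewrite fcons_lift.
set a := x ord0; set S := \sum_i _.
have leu : v (a *: lincomb u + S) <= v (a *: lincomb u).
  have -> : a *: lincomb u + S =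
      lincomb (a *: u + \sum_k x (lift ord0 k) *: b k).
    by rewrite lincombD lincomb_sum.
  apply: le_trans (val_lincomb_le _ i) _.
  rewrite !mxE summxE big1 => [|k _]; last by rewrite mxE bi mulr0.
  rewrite addr0 -scalerA !(val_scale _ a); case: (val_res K v a) => // g.
  case: (v (_ *: _)) (v (lincomb u)) ui => [?|] [?|] //=.
  by rewrite !wleE oag_leD2l.
have leS := val_addl_le leu.
move=> k; case: (unliftP ord0 k) => [j ->|->]; last by rewrite fcons0.
by rewrite fcons_lift; apply: le_trans leS (sb _ j).
Qed.

(** Induction on [m]: the pivot coordinate of the first vector is cleared from the others, induction
    treats these, and [separated_cons] puts the first vector back. *)
Lemma exists_separated_gens m (e : 'I_m -> 'rV[K]_d) :
  exists p (b : 'I_p -> 'rV[K]_d), [/\ forall k, b k != 0,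
    separated_family v (fun k => lincomb (b k)) & lin_span b = lin_span e].
Proof.
elim: m e => [|m IH] e.
  by exists 0%N, e; split=> [[]//||//]; apply/separatedP => x [].
pose u := e ord0; have [u0|u0] := eqVneq u 0.
  have [p [b [b0 sb be]]] := IH (fun k => e (lift ord0 k)).
  exists p, b; split=> //; rewrite be; apply/seteqP; split; apply: lin_span_subset.
    by move=> k; apply: lin_span_gen.
  move=> k; case: (unliftP ord0 k) => [j ->|->]; first exact: lin_span_gen.
  by rewrite -/u u0; apply: lin_span0.
have [i ui leu] := pivot u0.
pose e' k := - (e (lift ord0 k) 0 i / u 0 i) *: u + e (lift ord0 k).
have [p [b [b0 sb be]]] := IH e'.
(* Coordinate [i] vanishes on each [e' k], hence on their span. *)
have bi k : b k 0 i = 0.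
  have : lin_span e' (b k) by rewrite -be; apply: lin_span_gen.
  move=> [c ->]; rewrite summxE big1// => j _.
  by rewrite !mxE mulNr divfK// addNr mulr0.
have bu : lin_span (fcons u b) u.
  by rewrite -{2}[u](fcons0 u b); apply: lin_span_gen.
have bb : lin_span b `<=` lin_span (fcons u b).
  by apply: lin_span_subset => k; rewrite -(fcons_lift u b); apply: lin_span_gen.
have eu : lin_span e u by apply: lin_span_gen.
exists p.+1, (fcons u b); split; first exact: (@fcons_forall _ (fun w => w != 0)).
  exact: separated_cons leu bi sb.
apply/seteqP; split; apply: lin_span_subset => k.
  apply: (@fcons_forall _ (lin_span e)) => // j.
  suff: lin_span e' `<=` lin_span e by apply; rewrite -be; apply: lin_span_gen.
  by apply: lin_span_subset => t; apply: lin_spanD;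
    [apply: lin_spanZ|apply: lin_span_gen].
case: (unliftP ord0 k) => [j ->|->//].
have -> : e (lift ord0 j) = (e (lift ord0 j) 0 i / u 0 i) *: u + e' j.
  by rewrite /e' addrA -scalerDl subrr scale0r add0r.
by apply: lin_spanD; [apply: lin_spanZ|apply: bb; rewrite be; apply: lin_span_gen].
Qed.

Lemma lin_span_lincomb m (e : 'I_m -> 'rV[K]_d) :
  lin_span (fun k => lincomb (e k)) = lincomb @` lin_span e.
Proof.
apply/seteqP; split=> [_ [c ->]|_ [_ [c ->] <-]].
  by exists (\sum_k c k *: e k); [exists c|apply: lincomb_sum].
by exists c; apply: lincomb_sum.
Qed.

(** Elimination is applied to the coordinate rows of the generators of [M] with respect to [l]. *)
Lemma separated_basis_vs_defectless :
  lin_span l = [set: L] -> vs_defectless v.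
Proof.
move=> lT M [m [e ->]].
have [A eA] := @lin_span_coef _ _ _ _ e l (fun i => ltac:(by rewrite lT)).
have [p [b [b0 sb be]]] := exists_separated_gens (fun k => row k A).
have bn0 k : lincomb (b k) != 0 by apply: contra_neq (b0 k); apply: lincomb_eq0.
exists p, (fun k => lincomb (b k)); split=> //; split.
  exact: separated_lin_indep.
rewrite lin_span_lincomb be -lin_span_lincomb; congr lin_span.
by apply: funext => k; rewrite eA; apply: eq_bigr => j _; rewrite mxE.
Qed.
End GramSchmidt.

Theorem proposition1p16 (K : fieldType) (L : extFieldType K) (G : oagType)
    (v : valuation L G)
    (rank_fin : finite_rank (value_group (val_res K v))) :
  [/\ forall (n : nat) (l : 'I_n -> L), (forall i, l i != 0) ->
        (separated_family v l <-> lin_indep (fun i => ini v (l i) : gr_over v)),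
      forall (n : nat) (l : 'I_n -> L), (forall i, l i != 0) ->
        maximal_separated_family v l ->
        is_basis [set: gr_over v] (fun i => ini v (l i) : gr_over v)
    & forall d : nat, has_dim L d ->
        (vs_defectless v <-> has_dim (gr_over v) d)].
Proof.
have maxb n (l : 'I_n -> L) : maximal_separated_family v l ->
    is_basis [set: gr_over v] (fun i => ini v (l i) : gr_over v).
  move=> ml; split; last exact: maximal_separated_span.
  by case: ml => l0 sl _; apply: separated_lin_indep_ini.
split=> [n l l0|n l _|d dimL]; first by split;
  [exact: separated_lin_indep_ini|exact: lin_indep_ini_separated].
- exact: maxb.
split=> [vd|[f bf]].
  have [e be] := dimL.
  (* A separated basis of [L] itself has [d] elements, and no separated family of nonzero elements
     is longer, so it is maximal. *)
  have [|n [b [bb sb]]] := vd [set: L]; first by exists d, e; case: be.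
  have nd := is_basis_size bb be; subst n.
  have b0 i : b i != 0 by apply: lin_indep_neq0; case: bb.
  exists (fun i => ini v (b i) : gr_over v); apply: maxb.
  by apply: separated_maximal => // m l' l'0; apply: separated_size_leq be l'0.
have [n [l ml]] := exists_maximal_separated v dimL.
(* Comparison with [f] gives [l] exactly [d] elements; being independent, it is then a basis of
   [L]. *)
have nd := is_basis_size (maxb _ _ ml) bf; subst n.
have [e be] := dimL; case: ml => l0 sl _.
apply: (separated_basis_vs_defectless l0 sl).
by case: (lin_indep_basis be (separated_lin_indep l0 sl)).
Qed.
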